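(* Let $(X,d)$ be a compact metric space, let $\mu_1,\mu_{-1}\in\mathscr{P}(X)$, let $m\in\mathscr{P}(X)$ have full support, and for $i=\pm1$ let $l_i:\mathbb{R}\to\mathbb{R}_+$ be convex and differentiable and let $c_i:X\times X\to\mathbb{R}_+$ be continuous with $c_i(x,x)=0$ for every $x\in X$. Assume that - $l_1$ is (strictly) decreasing, $l_{-1}$ is (strictly) increasing, and $\lim_{t\to-\infty}l_1(t)=\lim_{t\to+\infty}l_{-1}(t)=+\infty$; - for $i=\pm1$, $c_i$ is Lipschitz in its second variable, uniformly in the first one (i.e. there is $L\ge0$ with $|c_i(x,z)-c_i(x,z')|\le L\,d(z,z')$ for all $x,z,z'\in X$); - there is $\delta>0$ such that $$\liminf_{r\to0^+}\ \inf_{x\in X}\ \frac{m(B(x,r))}{r^{\delta}}>0 .$$ Then $$0\le\overline{v}-\overline{v}_\varepsilon=O\big(\varepsilon\log(1/\varepsilon)\big)\quad\text{as }\varepsilon\downarrow0 .$$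
   Context: $\mathbb{R}_+=[0,+\infty)$; $\mathscr{P}(X)$ is the set of Borel probability measures on $X$, $C(X)$ the set of continuous real-valued functions on $X$, and $B(x,r)$ is the ball of center $x$ and radius $r$ in $X$. The value of the classifier's problem is $$\overline{v}:=\inf_{h\in C(X)}\sum_{i=\pm1}\int_X\max_{z\in X}\{l_i(h(z))-c_i(x,z)\}\,\mathrm{d}\mu_i(x),$$ and, for $\varepsilon>0$, the value of its softmax regularization is $$\overline{v}_\varepsilon:=\inf_{h\in C(X)}\sum_{i=\pm1}\int_X\varepsilon\log\Big(\int_X\exp\Big(\frac{l_i(h(z))-c_i(x,z)}{\varepsilon}\Big)\mathrm{d}m(z)\Big)\mathrm{d}\mu_i(x).$$ *)

(* Defs.v *)
From HB Require Import structures.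
From mathcomp Require Import all_boot all_order all_algebra.
From mathcomp Require Import all_classical all_reals all_analysis.
Import Order.TTheory GRing.Theory Num.Theory.
Import numFieldNormedType.Exports.

Set Implicit Arguments.
Unset Strict Implicit.
Unset Printing Implicit Defensive.

Local Open Scope classical_set_scope.
Local Open Scope ring_scope.
Local Open Scope ereal_scope.

(* Generated sigma-algebras are only measurable types over pointed types. Being
   pointed amounts to being nonempty, which holds for any space that carries a
   probability measure. *)
#[short(type="pointedMetricType")]
HB.structure Definition PointedMetric (K : numDomainType) :=
  { M of Metric K M & isPointed M }.

Notation borel X := (g_sigma_algebraType (@open X)).

(* The two labels i = 1 and i = -1 are encoded as [true] and [false].
   Infima, suprema and integrals are taken in the extended reals, so that no
   default value is involved. *)
Section classifier.
Context {R : realType} {X : pointedMetricType R}.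
Variables (mu : bool -> probability (borel X) R).
Variables (l : bool -> R -> R) (c : bool -> X -> X -> R).

Definition classifier_risk (h : X -> R) : \bar R :=
  \sum_(i : bool) \int[mu i]_x
    ereal_sup [set (l i (h z) - c i x z)%:E | z in [set: X]].

Definition classifier_value : \bar R :=
  ereal_inf [set classifier_risk h | h in [set h : X -> R | continuous h]].

Variables (m : probability (borel X) R) (eps : R).

Definition softmax_risk (h : X -> R) : \bar R :=
  \sum_(i : bool) \int[mu i]_x
    (eps%:E * lne (\int[m]_z (expR ((l i (h z) - c i x z) / eps))%:E)).

Definition softmax_value : \bar R :=
  ereal_inf [set softmax_risk h | h in [set h : X -> R | continuous h]].

End classifier.

Definition full_support {R : realType} {X : pointedMetricType R}
    (m : probability (borel X) R) : Prop :=
  forall U : set X, open U -> U !=set0 -> 0 < m U.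

(* Main.v *)
Require Import Defs.
From HB Require Import structures.
From mathcomp Require Import all_boot all_order all_algebra.
From mathcomp Require Import all_classical all_reals all_analysis.
From mathcomp Require Import measurable_realfun lra.
Import Order.TTheory GRing.Theory Num.Theory.
Import numFieldNormedType.Exports.

(** Softmax regularization decreases the risk, because the logarithmic mean of
    an exponential is at most the supremum; hence the sign of the difference.

    The rate comes from a transformation of classifiers
    ([exists_regularized_classifier]): every continuous [h] can be replaced by
    a continuous [h'] whose unregularized loss is, at every point and for both
    labels, at most the softmax loss of [h] plus [eta], for any
    [eta > L * r - eps * ln (q / 2)], where [L] is a Lipschitz constant of the
    costs and [q] a lower bound of the mass of the balls of radius [r]. With
    [r = eps] and [q = k * eps `^ delta] this [eta] is [O (eps ln (1 / eps))],
    and taking infima over [h] gives the bound.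

    To build [h'], let [g i x] be the softmax loss of [h] at [x] for the label
    [i]. A set [E] of mass at least [q / 2] inside the ball of center [z] and
    radius [r] on which [l i (h w) >= a] contributes enough to the exponential
    mean to force [a <= g i x + c i x z + gap] for every [x], where
    [gap = L * r - eps * ln (q / 2)] ([half_ball_loss_le]). Given a level [t],
    one of [h <= t] and [h > t] fills half of the ball. As the two losses are
    monotone in opposite directions, this bounds [l true t] in the first case
    and [l false t] in the second ([loss_dichotomy]). Choose now [h' z] by
    [l true (h' z) = inf_x (g true x + c true x z) + eta]: the bound for the
    label [true] holds by construction, and since [eta > gap] this level is too
    large for the first alternative at [t = h' z], so the second one gives the
    bound for the label [false]. The infimum is Lipschitz in [z], as [c true]
    is, and [l true] is strictly decreasing, so [h'] is continuous however
    irregular [h] may be at scale [r].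

    Measurability, integrability and finiteness are treated at once for the
    supremum and the softmax: both are monotone and commute with the addition
    of constants ([topical]), hence are nonexpansive for the uniform norm. *)

Set Implicit Arguments.
Unset Strict Implicit.
Unset Printing Implicit Defensive.

Local Open Scope classical_set_scope.
Local Open Scope ring_scope.

(** * Continuous functions on a compact metric space *)

Section ContinuousFunctions.
Context {R : realType} {X : pointedMetricType R}.
Hypothesis X_compact : compact [set: X].
Implicit Types f : X -> R.

Lemma open_borel_measurable (A : set X) :
  open A -> measurable (A : set (borel X)).
Proof. exact: sub_sigma_algebra. Qed.

Lemma ball_open_metric (x : X) (r : R) : open (ball x r).
Proof.
rewrite openE => y; rewrite ballEmdist /= => xy.
have r0 : 0 < r - mdist x y by rewrite subr_gt0.
apply/nbhs_ballP; exists (r - mdist x y) => //= z; rewrite !ballEmdist /= => yz.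
by rewrite (le_lt_trans (metric_triangle _ y _))// addrC -ltrBrDr.
Qed.

Lemma continuous_borel_measurable f :
  continuous f -> measurable_fun [set: borel X] (f : borel X -> R).
Proof.
move=> cf; apply: (measurability _ (RGenOInfty.measurableE R)).
move=> _ [_ [a ->] <-]; rewrite setTI; apply: open_borel_measurable.
by move/continuousP: cf; apply; exact: interval_open.
Qed.

Lemma continuous_norm_bounded f :
  continuous f -> exists M, forall x, `|f x| <= M.
Proof.
move=> cf.
have /compact_bounded[M [_ fM]] : compact (range f).
  by apply: continuous_compact => //; apply: continuous_subspaceT.
by exists (M + 1) => x; apply: fM; [rewrite ltrDl|exists x].
Qed.

Lemma continuous_borel_integrable (mu : probability (borel X) R) f :
  continuous f -> mu.-integrable [set: borel X] (EFin \o f).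
Proof.
move=> cf; have [M fM] := continuous_norm_bounded cf.
apply: measurable_bounded_integrable => //.
- exact: le_lt_trans (probability_le1 mu measurableT) (ltry 1).
- exact: continuous_borel_measurable.
- exists M; split; rewrite ?num_real// => N MN x _ /=.
  by rewrite (le_trans (fM x))// ltW.
Qed.

Section Slices.
Variable c : X -> X -> R.
Hypothesis c_continuous : continuous (fun p : X * X => c p.1 p.2).

Lemma continuous_slice x : continuous (c x).
Proof.
move=> z; apply: (@continuous_comp _ _ _ (fun z => (x, z))
  (fun p : X * X => c p.1 p.2)); last exact: c_continuous.
by apply: cvg_pair => /=; [exact: cvg_cst|exact: cvg_id].
Qed.

(** This uniformity in [z] is what makes the losses continuous, hence
    measurable, in the data point; it uses the compactness of the space of
    the [z]. *)
Lemma uniform_continuous_slice x (e : R) : 0 < e ->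
  \forall x' \near x, forall z, `|c x z - c x' z| <= e.
Proof.
move=> e0.
have /compact_near_coveringP /(_ X (nbhs x)
  (fun x' z => `|c x z - c x' z| <= e)) := X_compact.
suff H : forall z0, [set: X] z0 ->
    \forall z \near z0 & x' \near x, `|c x z - c x' z| <= e.
  by move=> /(_ _ H); apply: filterS => x' + z; exact.
move=> z0 _.
have e2 : 0 < e / 2 by rewrite divr_gt0.
have /cvgrPdist_le /(_ _ e2) [[A B] /= [xA zB] AB] := @c_continuous (x, z0).
exists (B, A) => //= -[z x'] /= [Bz Ax'].
have := AB (x, z) (conj (nbhs_singleton xA) Bz).
have := AB (x', z) (conj Ax' Bz) => /=.
rewrite !ler_distl => /andP[? ?] /andP[? ?].
apply/andP; split; lra.
Qed.

End Slices.

End ContinuousFunctions.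

(** * Monotone functionals commuting with constants *)

Section Topical.
Context {R : realType} {X : pointedMetricType R}.
Implicit Types (f g : X -> R) (Phi : (X -> R) -> \bar R).

(** Monotonicity and compatibility with the addition of constants are merged
    into one inequality. Together with the value at [0] they are all that the
    integrability of the losses and their comparison with a supremum need. *)
Definition topical Phi : Prop :=
  Phi (cst 0) = 0%E /\
  forall f g a, continuous f -> continuous g ->
    (forall z, f z <= g z + a) -> (Phi f <= Phi g + a%:E)%E.

Definition sup_value f : \bar R := ereal_sup [set (f z)%:E | z in [set: X]].

Definition log_mean_exp (m : probability (borel X) R) (eps : R) f : \bar R :=
  (eps%:E * lne (\int[m]_z (expR (f z / eps))%:E))%E.

Hypothesis X_compact : compact [set: X].

Section TopicalTheory.
Variable Phi : (X -> R) -> \bar R.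
Hypothesis Phi_topical : topical Phi.

(** A continuous function on a compact space lies between two constants. *)
Lemma topical_fin_num f : continuous f -> Phi f \is a fin_num.
Proof.
move=> cf; have [M fM] := continuous_norm_bounded X_compact cf.
have c0 : continuous (cst 0 : X -> R) by exact: cst_continuous.
have [Phi0 Phi_le] := Phi_topical.
have f_le z : f z <= cst 0 z + M.
  by rewrite add0r (le_trans (ler_norm _)).
have f_ge z : cst 0 z <= f z + M.
  by rewrite -lerBlDr sub0r lerNl (le_trans (ler_norm _))// normrN.
have := Phi_le _ _ _ cf c0 f_le; have := Phi_le _ _ _ c0 cf f_ge.
by rewrite Phi0; case: (Phi f).
Qed.

(** Monotonicity applied to [f <= 0 + sup f]; the value [+oo] is trivial. *)
Lemma topical_le_sup f : continuous f -> (Phi f <= sup_value f)%E.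
Proof.
move=> cf; have [Phi0 Phi_le] := Phi_topical.
case sf : (sup_value f) => [s||]; rewrite ?leey//; last first.
  have := @ereal_sup_ubound _ [set (f z)%:E | z in [set: X]] (f point)%:E.
  rewrite -/(sup_value f) sf leeNy_eq => H.
  by have /H : [set (f z)%:E | z in [set: X]] (f point)%:E by exists point.
have c0 : continuous (cst 0 : X -> R) by exact: cst_continuous.
rewrite -[leRHS]add0e -Phi0; apply: Phi_le => // z.
by rewrite add0r -lee_fin -sf; apply: ereal_sup_ubound; exists z.
Qed.

Section Parametrized.
Variables (u : X -> R) (c : X -> X -> R).
Hypothesis u_continuous : continuous u.
Hypothesis c_continuous : continuous (fun p : X * X => c p.1 p.2).

Lemma continuous_gain x : continuous (fun z => u z - c x z).
Proof.
move=> z; apply: cvgB; first exact: u_continuous.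
exact: continuous_slice.
Qed.

Lemma topical_gain_fin_num x : Phi (fun z => u z - c x z) \is a fin_num.
Proof. by apply: topical_fin_num; exact: continuous_gain. Qed.

(** Nonexpansiveness turns the uniform closeness of the slices [c x] and
    [c x'] into closeness of the values of [Phi]. *)
Lemma topical_gain_continuous :
  continuous (fun x => fine (Phi (fun z => u z - c x z))).
Proof.
move=> x; apply/cvgrPdist_le => e e0.
have := uniform_continuous_slice X_compact c_continuous x e0.
apply: filterS => x' cxx'.
have [_ Phi_le] := Phi_topical.
have le_e y y' : (forall z, `|c y z - c y' z| <= e) ->
    fine (Phi (fun z => u z - c y z)) <= fine (Phi (fun z => u z - c y' z)) + e.
  move=> cyy'; rewrite -lee_fin EFinD !fineK ?topical_gain_fin_num//.
  apply: Phi_le => [||z]; [exact: continuous_gain..|].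
  have := cyy' z; rewrite ler_distl => /andP[? ?]; lra.
have := le_e _ _ cxx'.
have /le_e : forall z, `|c x' z - c x z| <= e by move=> z; rewrite distrC.
by rewrite ler_distl => ? ?; apply/andP; split; lra.
Qed.

Lemma topical_gain_integrable (mu : probability (borel X) R) :
  mu.-integrable [set: borel X] (fun x => Phi (fun z => u z - c x z)).
Proof.
have := continuous_borel_integrable X_compact mu topical_gain_continuous.
apply: eq_integrable => // x _ /=.
by rewrite fineK// topical_gain_fin_num.
Qed.

End Parametrized.
End TopicalTheory.

Lemma topical_sup_value : topical sup_value.
Proof.
split=> [|f g a _ _ fga].
  apply/eqP; rewrite eq_le; apply/andP; split.
    by apply: ge_ereal_sup => _ [z _ <-].
  by apply: ereal_sup_ubound; exists point.
apply: ge_ereal_sup => _ [z _ <-].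
rewrite (@le_trans _ _ (g z + a)%:E) ?lee_fin// EFinD leeD2r//.
by apply: ereal_sup_ubound; exists z.
Qed.

Section LogMeanExp.
Variables (m : probability (borel X) R) (eps : R).
Hypothesis eps_gt0 : 0 < eps.

Lemma continuous_expR_div f :
  continuous f -> continuous (fun z => expR (f z / eps)).
Proof.
move=> cf z; apply: (@continuous_comp _ _ _ (fun z => f z / eps) expR).
  by apply: cvgMr_tmp; exact: cf.
exact: continuous_expR.
Qed.

(** Markov's inequality for the exponential. *)
Lemma mean_exp_ge (E : set (borel X)) f b : continuous f -> measurable E ->
  (forall z, E z -> b <= f z) ->
  ((expR (b / eps))%:E * m E <= \int[m]_z (expR (f z / eps))%:E)%E.
Proof.
move=> cf mE bf.
have mexp : measurable_fun [set: borel X] (fun z => (expR (f z / eps))%:E).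
  apply/measurable_EFinP; apply: continuous_borel_measurable.
  exact: continuous_expR_div.
rewrite -integral_cst//.
apply: (@le_trans _ _ (\int[m]_(z in E) (expR (f z / eps))%:E)%E).
  apply: ge0_le_integral => //.
  - by move=> z _; rewrite lee_fin expR_ge0.
  - exact: measurable_funTS.
  - by move=> z Ez; rewrite lee_fin ler_expR ler_pM2r ?invr_gt0// bf.
exact: ge0_subset_integral.
Qed.

Lemma mean_exp_fin_gt0 f : continuous f ->
  exists2 r : R, 0 < r & (\int[m]_z (expR (f z / eps))%:E)%E = r%:E.
Proof.
move=> cf.
have : (\int[m]_z (expR (f z / eps))%:E)%E \is a fin_num.
  apply: integrable_fin_num => //.
  by apply: continuous_borel_integrable => //; exact: continuous_expR_div.
have [M fM] := continuous_norm_bounded X_compact cf.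
have := @mean_exp_ge setT f (- M) cf measurableT.
rewrite probability_setT mule1 => mean_ge mean_fin.
exists (fine (\int[m]_z (expR (f z / eps))%:E)%E); last by rewrite fineK.
rewrite -lte_fin fineK//; apply: lt_le_trans (mean_ge _).
  by rewrite lte_fin expR_gt0.
by move=> z _; rewrite lerNl (le_trans (ler_norm _))// normrN.
Qed.

Lemma topical_log_mean_exp : topical (log_mean_exp m eps).
Proof.
split=> [|f g a cf cg fga].
  rewrite /log_mean_exp.
  have -> : (\int[m]_z (expR (cst 0 (z : X) / eps))%:E = 1)%E.
    rewrite -[RHS](probability_setT m) -[RHS]mul1e -integral_cst//.
    by apply: eq_integral => z _; rewrite mul0r expR0.
  by rewrite lne1 mule0.
have [r r0 fr] := mean_exp_fin_gt0 cf.
have [s s0 gs] := mean_exp_fin_gt0 cg.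
rewrite /log_mean_exp fr gs !lne_EFin// -!EFinM -EFinD lee_fin.
rewrite -ler_pdivlMl// mulrDr mulKf ?gt_eqF// [_ * a]mulrC -[a / eps]expRK.
rewrite -lnM ?posrE ?expR_gt0// ler_ln ?posrE ?mulr_gt0 ?expR_gt0//.
rewrite -lee_fin EFinM -fr -gs -ge0_integralZr//; last first.
  apply/measurable_EFinP; apply: continuous_borel_measurable.
  exact: continuous_expR_div.
apply: le_integral => //.
- by apply: continuous_borel_integrable => //; exact: continuous_expR_div.
- apply: integrableZr => //.
  by apply: continuous_borel_integrable => //; exact: continuous_expR_div.
move=> z _; rewrite -EFinM lee_fin -expRD ler_expR -mulrDl.
by rewrite ler_pM2r ?invr_gt0.
Qed.

(** A partial converse to [log_mean_exp <= sup_value]: a level reached on a set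
    of mass [q] is seen by the softmax up to the loss [- eps * ln q]. *)
Lemma log_mean_exp_ge (E : set (borel X)) f (b q : R) :
  continuous f -> measurable E -> 0 < q -> (q%:E <= m E)%E ->
  (forall z, E z -> b <= f z) ->
  ((b + eps * ln q)%:E <= log_mean_exp m eps f)%E.
Proof.
move=> cf mE q0 qE bf; rewrite /log_mean_exp.
have := mean_exp_ge cf mE bf.
have [r r0 ->] := mean_exp_fin_gt0 cf.
rewrite lne_EFin// -EFinM lee_fin => mr.
have : expR (b / eps) * q <= r.
  rewrite -lee_fin EFinM; apply: le_trans mr.
  by rewrite lee_pmul2l ?lte_fin ?expR_gt0.
rewrite -ler_ln ?posrE ?mulr_gt0 ?expR_gt0// lnM ?posrE ?expR_gt0// expRK.
move=> lnr; rewrite -ler_pdivrMl//.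
by rewrite mulrDr mulKf ?gt_eqF// mulrC.
Qed.

End LogMeanExp.
End Topical.

(** * The regularized classifier *)

(** The levels [phi (k x - e)] and [phi (k x + e)] strictly enclose
    [phi (k x)], so the continuity of [phi \o k] traps [k x'] between
    [k x - e] and [k x + e]. *)
Lemma continuous_decreasing_factor (R : realType) (T : topologicalType)
    (phi : R -> R) (k : T -> R) :
  decreasing_fun phi -> continuous (phi \o k) -> continuous k.
Proof.
move=> phi_dec ck x; apply/cvgrPdist_le => e e0.
have phi_lt a b : (phi b < phi a) = (a < b) by rewrite !ltNge phi_dec.
have dl : 0 < phi (k x) - phi (k x + e) by rewrite subr_gt0 phi_lt ltrDl.
have dr : 0 < phi (k x - e) - phi (k x).
  by rewrite subr_gt0 phi_lt ltrBlDr ltrDl.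
have /cvgrPdist_le /(_ _ dl) := ck x.
have /cvgrPdist_le /(_ _ dr) := ck x.
apply: filterS2 => x' /=; rewrite !ler_distl => /andP[? ?] /andP[? ?].
apply/andP; split; first by rewrite lerBlDr -phi_dec; lra.
by rewrite -lerBlDr -phi_dec; lra.
Qed.

Section RegularizedClassifier.
Context {R : realType} {X : pointedMetricType R}.
Variables (m : probability (borel X) R) (l : bool -> R -> R)
  (c : bool -> X -> X -> R) (L : R).
Hypothesis X_compact : compact [set: X].
Hypothesis l_continuous : forall i, continuous (l i).
Hypothesis c_continuous : forall i, continuous (fun p : X * X => c i p.1 p.2).
Hypothesis l1_decreasing : decreasing_fun (l true).
Hypothesis lN1_increasing : increasing_fun (l false).
Hypothesis l1_cvg : l true t @[t --> -oo] --> +oo.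
Hypothesis c_lipschitz :
  forall i x z z', `|c i x z - c i x z'| <= L * mdist z z'.
Hypothesis L_ge0 : 0 <= L.

Variables (eps r q : R).
Hypothesis eps_gt0 : 0 < eps.
Hypothesis q_gt0 : 0 < q.
Hypothesis ball_mass : forall x, (q%:E <= m (ball x r))%E.

Definition gain (h : X -> R) i x : X -> R := fun z => l i (h z) - c i x z.

Variable h : X -> R.
Hypothesis h_continuous : continuous h.

Lemma loss_continuous i : continuous (fun z => l i (h z)).
Proof.
by move=> z; apply: continuous_comp; [exact: h_continuous|exact: l_continuous].
Qed.

Let g i x := fine (log_mean_exp m eps (gain h i x)).
Let gap := L * r - eps * ln (q / 2).

Lemma fine_softmaxE i x :
  (g i x)%:E = log_mean_exp m eps (gain h i x).
Proof.
rewrite /g fineK//; apply: topical_gain_fin_num => //.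
- exact: topical_log_mean_exp.
- exact: loss_continuous.
Qed.

(** On the ball of radius [r] the cost varies by at most [L * r], so that the
    gain is at least [a - c i x z - L * r] on [E]. *)
Lemma half_ball_loss_le i x z a (E : set (borel X)) : measurable E ->
  E `<=` ball z r -> ((q / 2)%:E <= m E)%E ->
  (forall w, E w -> a <= l i (h w)) -> a <= g i x + c i x z + gap.
Proof.
move=> mE Ez qE aE.
have cg : continuous (gain h i x).
  by apply: continuous_gain => //; exact: loss_continuous.
have q2 : 0 < q / 2 by rewrite divr_gt0.
have := @log_mean_exp_ge _ _ X_compact m _ eps_gt0 E _
  (a - c i x z - L * r) _ cg mE q2 qE.
rewrite -fine_softmaxE lee_fin => H.
suff : forall w, E w -> a - c i x z - L * r <= gain h i x w.
  by move/H => ?; rewrite /gap; lra.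
move=> w Ew; rewrite /gain.
have := aE w Ew.
have : L * mdist z w <= L * r.
  by apply: ler_wpM2l => //; have := Ez w Ew; rewrite ballEmdist => /ltW.
have := c_lipschitz i x z w; rewrite ler_distl => /andP[? ?] ? ?; lra.
Qed.

(** The ball splits into the parts where [h <= t] and where [h > t], and one of
    them has at least half of its mass. *)
Lemma loss_dichotomy z t :
  (forall x, l true t <= g true x + c true x z + gap) \/
  (forall x, l false t <= g false x + c false x z + gap).
Proof.
pose B : set (borel X) := ball z r.
have mB : measurable B.
  by apply: open_borel_measurable; exact: ball_open_metric.
pose A : set (borel X) := [set w | t < h w].
have mA : measurable A.
  apply: open_borel_measurable.
  rewrite (_ : A = h @^-1` [set s | t < s])//.
  by move/continuousP : h_continuous; apply; exact: open_gt.
have [qA|qA] := leP (q / 2)%:E (m (B `&` A)).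
  right=> x; apply: (@half_ball_loss_le _ _ _ _ (B `&` A)) => //.
  - exact: measurableI.
  - by move=> w [_ /ltW]; rewrite lN1_increasing.
left=> x; apply: (@half_ball_loss_le _ _ _ _ (B `\` A)) => //.
- exact: measurableD.
- have : (q%:E <= m B)%E by exact: ball_mass.
  have -> : m B = (m (B `\` A) + m (B `&` A))%E by exact: measureDI.
  have : m (B `&` A) \is a fin_num.
    by apply: fin_num_measure; exact: measurableI.
  have : m (B `\` A) \is a fin_num.
    by apply: fin_num_measure; exact: measurableD.
  move: (m _) (m _) qA => [a||] [b||]//.
  by rewrite -EFinD !lee_fin lte_fin => ? _ _ ?; lra.
- by move=> w [_ /= /negP]; rewrite -leNgt l1_decreasing.
Qed.

(** The c-transform of [g true]. *)
Let phi z := inf [set g true x + c true x z | x in [set: X]].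

(** The upper bound [t] of [h] puts every ball entirely in the first case of
    the dichotomy. *)
Lemma c_transform_lower_bound :
  exists t, forall x z, l true t - gap <= g true x + c true x z.
Proof.
have [M hM] := continuous_norm_bounded X_compact h_continuous.
exists M => x z; rewrite lerBlDr.
apply: (@half_ball_loss_le _ _ _ _ (ball z r)) => //.
- by apply: open_borel_measurable; exact: ball_open_metric.
- apply: le_trans (ball_mass z); rewrite lee_fin.
  by rewrite ler_pdivrMr// mulr_natr mulr2n lerDl ltW.
- by move=> w _; rewrite l1_decreasing (le_trans (ler_norm _)).
Qed.

Lemma c_transform_le x z : phi z <= g true x + c true x z.
Proof.
have [t t_le] := c_transform_lower_bound.
apply: ge_inf; last by exists x.
by exists (l true t - gap) => _ [y _ <-].
Qed.

Lemma le_c_transform a z :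
  (forall x, a <= g true x + c true x z) -> a <= phi z.
Proof.
move=> aP; apply: lb_le_inf; last by move=> _ [x _ <-].
by exists (g true point + c true point z); exists point.
Qed.

Lemma c_transform_continuous : continuous phi.
Proof.
have lip z z' : phi z - L * mdist z z' <= phi z'.
  apply: le_c_transform => x; have := c_transform_le x z.
  have := c_lipschitz true x z z'; rewrite ler_distl => /andP[? ?] ?; lra.
move=> z; apply/cvgrPdist_le => e e0.
have L1 : 0 < L + 1 by rewrite ltr_wpDl.
have d0 : 0 < e / (L + 1) by rewrite divr_gt0.
apply/nbhs_ballP; exists (e / (L + 1)) => //= z'; rewrite ballEmdist /= => zz'.
have : L * mdist z z' <= e.
  move: zz'; rewrite ltr_pdivlMr// => /ltW; apply: le_trans.
  by rewrite mulrC ler_wpM2l ?mdist_ge0// lerDl.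
have := lip z z'; have := lip z' z; rewrite metric_sym => ? ? ?.
by rewrite ler_distl; apply/andP; split; lra.
Qed.

(** Solving [l true (h' z) = phi z + eta] gives the bound for the label [true]
    at once. For the label [false] it comes from [loss_dichotomy] at the level
    [h' z], whose first alternative would give [phi z + eta <= phi z + gap]. *)
Lemma exists_regularized_classifier eta : gap < eta ->
  exists2 h' : X -> R, continuous h' & forall i x,
    (sup_value (gain h' i x) <=
     log_mean_exp m eps (gain h i x) + eta%:E)%E.
Proof.
move=> gap_eta.
have [tM tM_le] := c_transform_lower_bound.
have solve z : exists t, l true t = phi z + eta.
  (* The target level lies in the range of [l true]: it is exceeded near -oo
     and bounded below by the value at [tM]. *)
  have [t0 t0_ge] : exists t, phi z + eta <= l true t.
    by move/cvgryPge : l1_cvg => /(_ (phi z + eta)) /filter_ex.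
  have lM : l true tM <= phi z + eta.
    rewrite -lerBlDr; apply: le_c_transform => x; have := tM_le x z; lra.
  have t0M : t0 <= tM by rewrite -l1_decreasing (le_trans lM).
  have [||t _ lt] := @IVT R (l true) t0 tM (phi z + eta) t0M.
  - by apply: continuous_subspaceT.
  - by rewrite min_r ?max_l ?lM ?l1_decreasing.
  by exists t.
have [h' h'E] := choice solve.
exists h'.
  apply: (continuous_decreasing_factor l1_decreasing).
  rewrite (_ : l true \o h' = (fun z => phi z + eta)); last exact/funext.
  by move=> z; apply: cvgD; [exact: c_transform_continuous|exact: cvg_cst].
have bound i x z : l i (h' z) - c i x z <= g i x + eta.
  case: i; first by rewrite h'E; have := c_transform_le x z; lra.
  have [|/(_ x)] := loss_dichotomy z (h' z); last by lra.
  rewrite h'E => H.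
  have : phi z + eta - gap <= phi z.
    by apply: le_c_transform => y; have := H y; lra.
  lra.
move=> i x; rewrite -fine_softmaxE -EFinD.
by apply: ge_ereal_sup => _ [z _ <-]; rewrite lee_fin; exact: bound.
Qed.

End RegularizedClassifier.

(** * Risks and values *)

Section Risk.
Context {R : realType} {X : pointedMetricType R}.
Variables (mu : bool -> probability (borel X) R) (l : bool -> R -> R)
  (c : bool -> X -> X -> R).
Hypothesis X_compact : compact [set: X].
Hypothesis l_continuous : forall i, continuous (l i).
Hypothesis c_continuous : forall i, continuous (fun p : X * X => c i p.1 p.2).

(** With [sup_value] and [log_mean_exp m eps] for [Phi] this is, by conversion,
    the risk of the classifier and its softmax regularization. *)
Definition risk (Phi : (X -> R) -> \bar R) (h : X -> R) : \bar R :=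
  (\sum_(i : bool) \int[mu i]_x Phi (gain l c h i x))%E.

Lemma gain_integrable Phi h i : topical Phi -> continuous h ->
  (mu i).-integrable [set: borel X] (fun x => Phi (gain l c h i x)).
Proof.
move=> tPhi ch; apply: topical_gain_integrable => //.
exact: loss_continuous.
Qed.

Lemma risk_fin_num Phi h : topical Phi -> continuous h ->
  risk Phi h \is a fin_num.
Proof.
move=> tPhi ch; rewrite /risk big_bool fin_numD.
by rewrite !integrable_fin_num//; exact: gain_integrable.
Qed.

Lemma le_risk Phi Psi h h' (a : R) : topical Phi -> topical Psi ->
  continuous h -> continuous h' ->
  (forall i x, (Phi (gain l c h i x) <= Psi (gain l c h' i x) + a%:E)%E) ->
  (risk Phi h <= risk Psi h' + (a *+ 2)%:E)%E.
Proof.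
move=> tPhi tPsi ch ch' PhiPsi.
have le_int i : (\int[mu i]_x Phi (gain l c h i x) <=
    \int[mu i]_x Psi (gain l c h' i x) + a%:E)%E.
  have cst_int : (mu i).-integrable [set: borel X] (cst a%:E).
    by apply: (continuous_borel_integrable X_compact (mu i)
      (f := cst a)); exact: cst_continuous.
  have -> : a%:E = (\int[mu i]_x cst a%:E (x : borel X))%E.
    rewrite integral_cst// -[LHS]mule1; congr (_ * _)%E.
    exact/esym/probability_setT.
  rewrite -integralD//; last exact: gain_integrable.
  apply: le_integral => //; first exact: gain_integrable.
    by apply: integrableD => //; exact: gain_integrable.
by rewrite /risk !big_bool mulr2n EFinD addeACA; apply: leeD; exact: le_int.
Qed.

End Risk.

(** The infimum inside the inferior limit may be infinite as an extended real,
    so the constant is chosen below it. *)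
Lemma small_ball_mass (R : realType) (X : pointedMetricType R)
    (m : probability (borel X) R) (delta : R) :
  (0 < limf_einf
      (fun r : R => ereal_inf
        [set m (ball x r) * ((r `^ delta)^-1)%:E | x in [set: X]])
      0^'+)%E ->
  exists2 k : R, 0 < k & \forall r \near 0^'+, forall x : X,
    ((k * r `^ delta)%:E <= m (ball x r))%E.
Proof.
rewrite limf_einfE => /ereal_sup_gt[_ [V V0 <-]].
set s := ereal_inf _ => s0.
have [k k0 ks] : exists2 k : R, 0 < k & (k%:E <= s)%E.
  case: s s0 => [s|_|//]; last by exists 1; rewrite ?leey.
  by rewrite lte_fin => s0; exists s.
exists k => //; near=> r => x.
have r0 : 0 < r by near: r; exact: nbhs_right_gt.
have rd0 : 0 < r `^ delta by rewrite powR_gt0.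
rewrite EFinM -lee_pdivlMr//.
apply: (le_trans ks); apply: (@le_trans _ _ (ereal_inf
  [set m (ball x r) * ((r `^ delta)^-1)%:E | x in [set: X]])%E).
  by apply: ereal_inf_lbound; exists r => //; near: r.
by apply: ereal_inf_lbound; exists x.
Unshelve. all: by end_near. Qed.

Theorem proposition5p6 (R : realType) (X : pointedMetricType R)
    (mu : bool -> probability (borel X) R) (m : probability (borel X) R)
    (l : bool -> R -> R) (c : bool -> X -> X -> R) (delta : R)
    (X_compact : compact [set: X])
    (m_full : full_support m)
    (l_ge0 : forall i t, 0 <= l i t)
    (l_convex : forall i, convex_function [set: convex_lmodType R^o] (l i))
    (l_derivable : forall i t, derivable (l i) t 1)
    (c_ge0 : forall i x z, 0 <= c i x z)
    (c_continuous : forall i, continuous (fun p : X * X => c i p.1 p.2))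
    (c_diag : forall i x, c i x x = 0)
    (l1_decreasing : decreasing_fun (l true))
    (lN1_increasing : increasing_fun (l false))
    (l1_cvg : l true t @[t --> -oo] --> +oo)
    (lN1_cvg : l false t @[t --> +oo] --> +oo)
    (c_lipschitz : forall i, exists2 L : R, 0 <= L &
      forall x z z', `|c i x z - c i x z'| <= L * mdist z z')
    (delta_gt0 : 0 < delta)
    (m_ball : (0 < limf_einf
      (fun r : R => ereal_inf
        [set m (ball x r) * ((r `^ delta)^-1)%:E | x in [set: X]])
      0^'+)%E) :
  [/\ classifier_value mu l c \is a fin_num,
      forall eps : R, 0 < eps ->
        softmax_value mu l c m eps \is a fin_num /\
        (0 <= classifier_value mu l c - softmax_value mu l c m eps)%E &
      (fun eps : R =>
         fine (classifier_value mu l c - softmax_value mu l c m eps) : R^o)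
        =O_ (0^'+) (fun eps : R => eps * ln (1 / eps) : R^o)].
Proof.
have l_continuous i : continuous (l i).
  by move=> t; apply: differentiable_continuous; exact/derivable1_diffP.
have [L L_ge0 c_lip] : exists2 L : R, 0 <= L &
    forall i x z z', `|c i x z - c i x z'| <= L * mdist z z'.
  have [L1 L1_ge0 lip1] := c_lipschitz true.
  have [L2 L2_ge0 lip2] := c_lipschitz false.
  exists (L1 + L2) => [|[] x z z']; first exact: addr_ge0.
    by rewrite (le_trans (lip1 x z z'))// ler_wpM2r ?mdist_ge0// lerDl.
  by rewrite (le_trans (lip2 x z z'))// ler_wpM2r ?mdist_ge0// lerDr.
set C := classifier_value mu l c; set S := softmax_value mu l c m.
pose soft eps := log_mean_exp m eps.
have topS eps : 0 < eps -> topical (soft eps) by exact: topical_log_mean_exp.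
have topC := @topical_sup_value R X.
have c0 : continuous (cst 0 : X -> R) by exact: cst_continuous.
(* The point [z = x] costs nothing, and the losses are nonnegative. *)
have C_ge0 : (0 <= C)%E.
  apply: le_ereal_inf_tmp => _ [h ch <-].
  apply: sume_ge0 => i _; apply: integral_ge0 => x _.
  apply: (@le_trans _ _ (l i (h x) - c i x x)%:E).
    by rewrite c_diag subr0 lee_fin.
  by apply: ereal_sup_ubound; exists x.
have C_fin : C \is a fin_num.
  rewrite ge0_fin_numE//.
  apply: (@le_lt_trans _ _ (risk mu l c sup_value (cst 0))).
    by apply: ereal_inf_lbound; exists (cst 0).
  by rewrite ltey_eq risk_fin_num.
have S_le_C eps : 0 < eps -> (S eps <= C)%E.
  move=> e0; apply: le_ereal_inf_tmp => _ [h ch <-].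
  apply: (@le_trans _ _ (risk mu l c (soft eps) h)).
    by apply: ereal_inf_lbound; exists h.
  rewrite -[leRHS]adde0 (_ : 0%E = ((0 : R) *+ 2)%:E); last by rewrite mul0rn.
  apply: (@le_risk _ _ mu l c _ _ _ (soft eps) sup_value h h 0) => //.
    exact: topS.
  move=> i x; rewrite adde0; apply: topical_le_sup => //; first exact: topS.
  by apply: continuous_gain => //; exact: loss_continuous.
have C_le_S eps r q eta : 0 < eps -> 0 < q ->
    (forall x, (q%:E <= m (ball x r))%E) -> L * r - eps * ln (q / 2) < eta ->
    (C - (eta *+ 2)%:E <= S eps)%E.
  move=> e0 q0 mq gap_eta; apply: le_ereal_inf_tmp => _ [h ch <-].
  have [h' ch' h'_le] := exists_regularized_classifier X_compact l_continuous
    c_continuous l1_decreasing lN1_increasing l1_cvg c_lip L_ge0 e0 q0 mq ch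
    gap_eta.
  rewrite leeBlDr//.
  apply: (@le_trans _ _ (risk mu l c sup_value h')).
    by apply: ereal_inf_lbound; exists h'.
  by apply: (@le_risk _ _ mu l c _ _ _ sup_value (soft eps) h' h eta) => //;
    exact: topS.
have [k k0 mk] := small_ball_mass m_ball.
have S_fin eps : 0 < eps -> S eps \is a fin_num.
  move=> e0.
  have [r [r0 mr]] : exists r : R, 0 < r /\
      forall x : X, ((k * r `^ delta)%:E <= m (ball x r))%E.
    have /filter_ex[r [? ?]] : \forall r \near 0^'+, 0 < r /\
        forall x : X, ((k * r `^ delta)%:E <= m (ball x r))%E.
      by apply: filterI => //; exact: nbhs_right_gt.
    by exists r.
  have q0 : 0 < k * r `^ delta by rewrite mulr_gt0// powR_gt0.
  have gap_lt : L * r - eps * ln (k * r `^ delta / 2) <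
      L * r - eps * ln (k * r `^ delta / 2) + 1 by rewrite ltrDl.
  move: (C_le_S _ _ _ _ e0 q0 mr gap_lt) (S_le_C _ e0).
  by rewrite -(fineK C_fin); case: (S eps).
split=> // [eps e0|].
  split; first exact: S_fin.
  by rewrite suber_ge0; [exact: S_le_C|exact: S_fin].
apply/eqO_exP.
(* With radius [eps] and mass [k * eps `^ delta] the gap is [eps] times
   [L - ln (k / 2) + delta * ln (1 / eps)]; the [1] in [K] makes the
   comparison strict, and [ln (1 / eps) >= 1] absorbs [K]. *)
pose K : R := L + 1 - ln (k / 2).
have K_ge0 : 0 <= `|K| by exact: normr_ge0.
exists (2 * (`|K| + delta)); first by rewrite mulr_gt0// ltr_wpDl.
near=> eps.
have e0 : 0 < eps by near: eps; exact: nbhs_right_gt.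
have ln_inv : ln (1 / eps) = - ln eps by rewrite div1r lnV.
have ln_ge1 : 1 <= ln (1 / eps).
  rewrite ln_inv lerNr -[leRHS]expRK ler_ln ?posrE ?expR_gt0//.
  by near: eps; apply: nbhs_right_ltW; exact: expR_gt0.
have q0 : 0 < k * eps `^ delta by rewrite mulr_gt0// powR_gt0.
have gap_lt : L * eps - eps * ln (k * eps `^ delta / 2) <
    (`|K| + delta) * (eps * ln (1 / eps)).
  have -> : ln (k * eps `^ delta / 2) = ln (k / 2) - delta * ln (1 / eps).
    rewrite mulrAC [LHS]lnM ?posrE ?powR_gt0 ?divr_gt0// ln_powR.
    by rewrite ln_inv mulrN opprK.
  rewrite [L * eps]mulrC -mulrBr mulrCA ltr_pM2l//.
  have : `|K| <= `|K| * ln (1 / eps) by rewrite ler_peMr.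
  have := ler_norm K; rewrite [in X in X -> _]/K; lra.
have CS : (C - (((`|K| + delta) * (eps * ln (1 / eps))) *+ 2)%:E <= S eps)%E.
  by apply: (C_le_S _ _ _ _ e0 q0 _ gap_lt); near: eps.
have eln_ge0 : 0 <= eps * ln (1 / eps).
  by rewrite mulr_ge0 ?(ltW e0)// (le_trans _ ln_ge1).
move: (S_le_C _ e0) CS; rewrite -/C -/(S eps).
rewrite -(fineK C_fin) -(fineK (S_fin _ e0)) -!EFinB !lee_fin /= => SC CS.
rewrite ger0_norm ?subr_ge0// (ger0_norm eln_ge0); lra.
Unshelve. all: by end_near. Qed.
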